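(* The derivation of the extended tableau is valid; that is: if $\mathbf{T}=(G,\mathcal{G},\mathcal{M},\mathcal{X},\simeq)$ is a valid matroid tableau, then its extended tableau $[\mathbf{T}]_\equiv$ is a valid matroid tableau.
   Context: Matroids have finite ground sets; $M^\ast$ denotes the dual matroid of $M$. A digraph is a pair $D=(V,A)$ with $V$ finite and $A\subseteq V\times V$. A path in $D$ is a non-empty, non-repeating sequence of vertices $p_1p_2\ldots p_n$ with $(p_i,p_{i+1})\in A$ for $1\le i<n$. A routing from $X$ to $Y$ in $D$ is a family $R$ of paths in $D$ such that every $x\in X$ is the first vertex of some $p\in R$, every $p\in R$ ends in a vertex of $Y$, and any two distinct paths of $R$ are vertex-disjoint. For $E,T\subseteq V$, $\Gamma(D,T,E)$ is the matroid on $E$ whose independent sets are those $X\subseteq E$ for which there is a routing from $X$ to $T$ in $D$. A matroid $(E,\mathcal{I})$ is a gammoid if it equals $\Gamma(D,T,E)$ for some digraph $D=(V,A)$ with $E\subseteq V$ and some $T\subseteq V$; it is a strict gammoid if such a representation exists with $V=E$. A matroid tableau is a tuple $\mathbf{T}=(G,\mathcal{G},\mathcal{M},\mathcal{X},\simeq)$ where $G$ is a matroid (the goal), $\mathcal{G},\mathcal{M},\mathcal{X}$ are families of matroids, and $\simeq$ is an equivalence relation on $\{G'\mid G'\text{ is a minor of }G\}\cup\mathcal{G}\cup\mathcal{M}\cup\mathcal{X}$. $\mathbf{T}$ is valid if (i) all matroids in $\mathcal{G}$ are gammoids, (ii) no matroid in $\mathcal{M}$ is a strict gammoid, (iii) no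 matroid in $\mathcal{X}$ is a gammoid, and (iv) every equivalence class of $\simeq$ either consists only of gammoids or contains no gammoid. The extended tableau of $\mathbf{T}$ is $[\mathbf{T}]_\equiv=(G,\mathcal{G}',\mathcal{M}',\mathcal{X}',\simeq')$ with $\mathcal{G}'=\mathcal{G}\cup\{M^\ast\mid M\in\mathcal{G}\}$, $\mathcal{X}'=\mathcal{X}\cup\{M^\ast\mid M\in\mathcal{X}\}$, $\mathcal{M}'=\mathcal{M}\cup\mathcal{X}'$, and $\simeq'$ the smallest equivalence relation on $\{G'\mid G'\text{ is a minor of }G\}\cup\mathcal{G}'\cup\mathcal{M}'\cup\mathcal{X}'$ that contains $\simeq$ and $\sim$, where for matroids $M,N$ of this family $M\sim N$ if and only if $N$ is isomorphic to $M$ or to $M^\ast$. *)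

(* Defs.v *)
(* Matroids, gammoids and matroid tableaux over a type K of elements.
   Ground sets and vertex sets are finite subsets of K, so that matroids on
   different ground sets, and the vertices of a digraph lying outside the
   ground set, live in the same universe.  K is meant to be infinite: only then
   are there enough elements for the vertices of an arbitrary finite digraph
   containing a given ground set. *)
From mathcomp Require Import all_boot finmap.
From mathcomp Require Import boolp classical_sets cardinality.

Set Implicit Arguments.
Unset Strict Implicit.
Unset Printing Implicit Defensive.

Section Matroids.
Local Open Scope fset_scope.
Variable K : choiceType.
Implicit Types (X Y I J B C : {fset K}).

Record matroid := Matroid {
  ground : {fset K};
  indep : {fset {fset K}};
  indep_ground : forall X, X \in indep -> X `<=` ground;
  indep0 : fset0 \in indep;
  indep_sub : forall X Y, X `<=` Y -> Y \in indep -> X \in indep;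
  indep_aug : forall X Y, X \in indep -> Y \in indep -> #|` X| < #|` Y| ->
    exists2 y, y \in Y `\` X & y |` X \in indep }.

(* Leibniz equality of matroids is the usual equality of pairs (E, I). *)
Lemma matroid_eqP (M N : matroid) :
  ground M = ground N -> indep M = indep N -> M = N.
Proof.
case: M N => [E F a b c d] [E' F' a' b' c' d'] /= eE eF; subst E' F'.
by rewrite (Prop_irrelevance a a') (Prop_irrelevance b b')
           (Prop_irrelevance c c') (Prop_irrelevance d d').
Qed.

Definition bases (M : matroid) : {fset {fset K}} :=
  [fset B in indep M | [forall C : indep M, (B `<=` val C) ==> (val C == B)]].

Lemma basesP (M : matroid) B :
  reflect (B \in indep M /\ forall C, C \in indep M -> B `<=` C -> C = B)
          (B \in bases M).
Proof.
rewrite !inE /=; apply: (iffP andP) => -[BI maxB]; split=> //.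
  move=> C CI BC; move/forallP: maxB => /(_ [` CI]) /=.
  by rewrite BC => /eqP.
apply/forallP => -[C CI] /=; apply/implyP => BC.
exact/eqP/maxB.
Qed.

Lemma indep_extend (M : matroid) I J :
  I \in indep M -> J \in indep M -> #|` I| <= #|` J| ->
  exists C, [/\ C \in indep M, I `<=` C, C `<=` I `|` J & #|` C| = #|` J|].
Proof.
move=> II JI; move: {2}(_ - _) (leqnn (#|` J| - #|` I|)) => n.
elim: n I II => [|n IHn] I II.
  rewrite leqn0 subn_eq0 => JleI IleJ; exists I.
  by split=> //; [exact: fsubsetUl | apply/eqP; rewrite eqn_leq IleJ].
move=> le_n; rewrite leq_eqVlt => /predU1P[eqIJ | ltIJ].
  by exists I; split=> //; exact: fsubsetUl.
have [y] := indep_aug II JI ltIJ; rewrite inE => /andP[yNI yJ] yII.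
have card_yI : #|` y |` I| = #|` I|.+1 by rewrite cardfsU1 yNI.
have [||C [CI yIC Csub eqC]] := IHn _ yII.
- by rewrite card_yI subnS; case: (_ - _) le_n.
- by rewrite card_yI.
exists C; split=> //.
  by apply: fsubset_trans yIC; exact: fsubsetU1.
apply: fsubset_trans Csub _; rewrite fsubUset fsubsetUr andbT fsubUset.
by rewrite fsubsetUl andbT fsub1set inE yJ orbT.
Qed.

Lemma indep_card_base (M : matroid) I B :
  I \in indep M -> B \in bases M -> #|` I| <= #|` B|.
Proof.
move=> II /basesP[BI maxB]; rewrite leqNgt; apply/negP => ltBI.
have [y] := indep_aug BI II ltBI; rewrite inE => /andP[yNB _] yBI.
have /fsetP/(_ y) := maxB _ yBI (fsubsetU1 _ _).
by rewrite !inE eqxx (negPf yNB).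
Qed.

Lemma base_of_card (M : matroid) C B :
  C \in indep M -> B \in bases M -> #|` C| = #|` B| -> C \in bases M.
Proof.
move=> CI BB eqCB; apply/basesP; split=> // D DI CD.
apply/esym/eqP; rewrite eqEfcard CD eqCB.
exact: indep_card_base DI BB.
Qed.

Lemma base_exists (M : matroid) : exists B, B \in bases M.
Proof.
pose F (C : indep M) := #|` val C|.
case: (@arg_maxnP _ [` indep0 M] xpredT F isT) => -[B BI] _ maxB.
exists B; apply/basesP; split=> // C CI BC.
by apply/esym/eqP; rewrite eqEfcard BC; exact: (maxB [` CI] isT).
Qed.

Section Dual.
Variable M : matroid.

Definition coindep : {fset {fset K}} :=
  [fset X in fpowerset (ground M) |
     [exists B : bases M, X `<=` ground M `\` val B]].

Lemma coindepP X :
  reflect (exists2 B, B \in bases M & X `<=` ground M `\` B) (X \in coindep).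
Proof.
rewrite !inE /= fpowersetE; apply: (iffP andP) => [[_]|].
  by case/existsP => -[B BB] /= XB; exists B.
case=> B BB XB; split; first by move: XB; rewrite fsubsetD => /andP[].
by apply/existsP; exists [` BB].
Qed.

Fact coindep_ground X : X \in coindep -> X `<=` ground M.
Proof. by case/coindepP => B _; rewrite fsubsetD => /andP[]. Qed.

Fact coindep0 : fset0 \in coindep.
Proof.
by have [B BB] := base_exists M; apply/coindepP; exists B; rewrite ?fsub0set.
Qed.

Fact coindep_sub X Y : X `<=` Y -> Y \in coindep -> X \in coindep.
Proof.
move=> XY /coindepP[B BB YB]; apply/coindepP; exists B => //.
exact: fsubset_trans YB.
Qed.

Fact coindep_aug X Y : X \in coindep -> Y \in coindep -> #|` X| < #|` Y| ->
  exists2 y, y \in Y `\` X & y |` X \in coindep.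
Proof.
move=> /coindepP[B BB XB] /coindepP[B' BB' YB'] ltXY.
have [BI _] := basesP _ _ BB; have [B'I _] := basesP _ _ BB'.
have DI : B' `\` X \in indep M by apply: indep_sub B'I; exact: fsubsetDl.
have [C [CI DC Csub cardC]] := indep_extend DI BI (indep_card_base DI BB).
have BC : C \in bases M by exact: base_of_card cardC.
have CX x : x \in X -> x \notin C.
  move=> xX; apply/negP => /(fsubsetP Csub); rewrite !inE xX /=.
  by move/fsubsetP: XB => /(_ x xX); rewrite !inE => /andP[/negPf->].
have [sYC | /fsubsetPn[y yYX yNC]] := boolP (Y `\` X `<=` C); last first.
  exists y => //; apply/coindepP; exists C => //.
  apply/fsubsetP => z; rewrite !inE => /predU1P[-> | zX].
    rewrite yNC; move: yYX; rewrite inE => /andP[_ /(fsubsetP YB')].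
    by rewrite inE => /andP[].
  by rewrite CX //; move/(fsubsetP XB): zX; rewrite inE => /andP[].
have dis : (Y `\` X) `&` (B' `\` X) = fset0.
  apply/fsetP => z; rewrite !inE; apply/negP => /andP[/andP[_ zY] /andP[_ zB]].
  by move/(fsubsetP YB'): zY; rewrite inE zB.
have leC : #|` Y `\` X| + #|` B' `\` X| <= #|` C|.
  rewrite -cardfsUI dis cardfs0 addn0.
  by apply: fsubset_leq_card; rewrite fsubUset sYC.
have leB : #|` C| <= #|` B'| by exact: indep_card_base CI BB'.
have leX : #|` B' `&` X| <= #|` X `\` Y|.
  apply: fsubset_leq_card; apply/fsubsetP => z; rewrite !inE => /andP[zB ->].
  by rewrite andbT; apply/negP => /(fsubsetP YB'); rewrite inE zB.
have := leq_trans leC leB; rewrite -(cardfsID X B') addnC.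
rewrite [leqRHS]addnC leq_add2l => /leq_trans/(_ leX).
rewrite -(leq_add2l #|` X `&` Y|) cardfsID fsetIC cardfsID.
by rewrite leqNgt ltXY.
Qed.

Definition dual : matroid :=
  Matroid coindep_ground coindep0 coindep_sub coindep_aug.

End Dual.

Section Deletion.
Variables (M : matroid) (Z : {fset K}).

Definition indep_del : {fset {fset K}} :=
  [fset X in indep M | X `<=` ground M `\` Z].

Fact indep_del_ground X : X \in indep_del -> X `<=` ground M `\` Z.
Proof. by rewrite !inE => /andP[]. Qed.

Fact indep_del0 : fset0 \in indep_del.
Proof. by rewrite !inE /= indep0 fsub0set. Qed.

Fact indep_del_sub X Y : X `<=` Y -> Y \in indep_del -> X \in indep_del.
Proof.
move=> XY; rewrite !inE /= => /andP[YI YZ].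
by rewrite (indep_sub XY YI) (fsubset_trans XY YZ).
Qed.

Fact indep_del_aug X Y : X \in indep_del -> Y \in indep_del ->
  #|` X| < #|` Y| -> exists2 y, y \in Y `\` X & y |` X \in indep_del.
Proof.
rewrite !inE /= => /andP[XI XZ] /andP[YI YZ] ltXY.
have [y yYX yXI] := indep_aug XI YI ltXY; exists y => //.
rewrite !inE /= yXI fsubUset XZ andbT fsub1set (fsubsetP YZ) //.
by move: yYX; rewrite inE => /andP[].
Qed.

Definition deletion : matroid :=
  Matroid indep_del_ground indep_del0 indep_del_sub indep_del_aug.

End Deletion.

Definition contraction (M : matroid) (Z : {fset K}) : matroid :=
  dual (deletion (dual M) Z).

Definition minor (N M : matroid) : Prop :=
  exists X Y, [/\ X `<=` ground M, Y `<=` ground M, [disjoint X & Y]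
                & N = deletion (contraction M X) Y].

(* Only the values of f on the ground set of M matter. *)
Definition isomorphic (M N : matroid) : Prop :=
  exists f : K -> K,
    [/\ {in ground M &, injective f}, f @` ground M = ground N
      & forall X, X `<=` ground M -> (X \in indep M) = (f @` X \in indep N)].

Record digraph := Digraph {
  vertices : {fset K};
  arcs : {fset K * K};
  arcs_vertices : arcs `<=` vertices `*` vertices }.

Definition is_path (D : digraph) (p : seq K) : Prop :=
  [/\ p <> [::], {subset p <= vertices D}, uniq p
    & sorted (fun u v => (u, v) \in arcs D) p].

Definition starts_at (p : seq K) (x : K) : Prop := exists q, p = x :: q.
Definition ends_at (p : seq K) (y : K) : Prop := exists q, p = rcons q y.

Definition is_routing (D : digraph) (X Y : {fset K}) (R : {fset seq K}) :
    Prop :=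
  [/\ forall p, p \in R -> is_path D p,
      forall x, x \in X -> exists2 p, p \in R & starts_at p x,
      forall p, p \in R -> exists2 y, y \in Y & ends_at p y
    & forall p q, p \in R -> q \in R -> p <> q ->
        forall z, ~ (z \in p /\ z \in q)].

(* M = Gamma(D, T, E), with E the ground set of M. *)
Definition represents (D : digraph) (T : {fset K}) (M : matroid) : Prop :=
  [/\ ground M `<=` vertices D, T `<=` vertices D
    & forall X, X \in indep M <->
        X `<=` ground M /\ exists R, is_routing D X T R].

Definition gammoid (M : matroid) : Prop := exists D T, represents D T M.

Definition strict_gammoid (M : matroid) : Prop :=
  exists D T, vertices D = ground M /\ represents D T M.

End Matroids.

Section Tableaux.
Local Open Scope classical_set_scope.
Variable K : choiceType.
Notation mat := (matroid K).
Implicit Types (S : set mat) (R : set (mat * mat)).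

Definition equivalence_on S R : Prop :=
  [/\ R `<=` S `*` S,
      forall M, S M -> R (M, M),
      forall M N, R (M, N) -> R (N, M)
    & forall L M N, R (L, M) -> R (M, N) -> R (L, N)].

Record tableau_data := TableauData {
  goal : mat;
  gammoids : set mat;
  nonstrict : set mat;
  nongammoids : set mat;
  teq : set (mat * mat) }.

Definition tableau_family (G : mat) (GG MM XX : set mat) : set mat :=
  [set N | minor N G] `|` GG `|` MM `|` XX.

Definition family (T : tableau_data) : set mat :=
  tableau_family (goal T) (gammoids T) (nonstrict T) (nongammoids T).

Definition is_tableau (T : tableau_data) : Prop :=
  equivalence_on (family T) (teq T).

Definition teq_class (T : tableau_data) (M : mat) : set mat :=
  [set N | teq T (M, N)].

Definition valid (T : tableau_data) : Prop :=
  [/\ forall M, gammoids T M -> gammoid M,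
      forall M, nonstrict T M -> ~ strict_gammoid M,
      forall M, nongammoids T M -> ~ gammoid M
    & forall M, family T M ->
        (forall N, teq_class T M N -> gammoid N) \/
        (forall N, teq_class T M N -> ~ gammoid N)].

Definition iso_or_dual S : set (mat * mat) :=
  [set MN | [/\ S MN.1, S MN.2
              & isomorphic MN.2 MN.1 \/ isomorphic MN.2 (dual MN.1)]].

Definition extended (T : tableau_data) : tableau_data :=
  let GG := gammoids T `|` [set dual M | M in gammoids T] in
  let XX := nongammoids T `|` [set dual M | M in nongammoids T] in
  let MM := nonstrict T `|` XX in
  let S := tableau_family (goal T) GG MM XX in
  TableauData (goal T) GG MM XX
    (smallest (equivalence_on S) (teq T `|` iso_or_dual S)).

End Tableaux.

(* Main.v *)
(* Gammoids are closed under isomorphism and duality, so "M is a gammoid iff N is"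
   is an equivalence relation containing both generators of the extended one.

   A set X is linked to T in D iff the vertices outside T can be matched
   injectively with vertices outside X, each v going to itself or to an
   out-neighbour (Ingleton-Piff).  This makes base exchange a relabelling: if h
   is the matching for a base B, giving to h v the arcs of v yields a
   representation whose targets are sinks and contain B, and then B alone
   suffices as target set.  If E was first made a set of sources outside the
   targets (by moving D to fresh vertices, hence the infinite K, and adding an arc
   from each x in E to its copy), the elements of E outside B remain sources.  Reversing paths in such a representation turns
   linkings onto B into linkings onto the complement of B in E, so the reversed
   digraph with targets E minus B represents the dual. *)
Require Import Defs.
From mathcomp Require Import all_boot finmap.
From mathcomp Require Import boolp classical_sets cardinality.

Set Implicit Arguments.
Unset Strict Implicit.
Unset Printing Implicit Defensive.

Section Linkings.
Local Open Scope fset_scope.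
Variable K : choiceType.
Implicit Types (D : digraph K) (X Y T V W : {fset K}) (M N : matroid K).

(** * Linkings, and their equivalence with routings and with matchings *)

Definition arc D : rel K := fun u v => (u, v) \in arcs D.

Lemma arc_vertices D u v :
  arc D u v -> u \in vertices D /\ v \in vertices D.
Proof.
move=> /(fsubsetP (arcs_vertices D)).
by rewrite in_fsetM /= => /andP.
Qed.

(** [L x] is the path from [x] without its first vertex, so the starting point is built in, and the
    further paths that a routing may contain are left out. *)
Definition linked D T X : Prop := exists L : K -> seq K,
  (forall x, x \in X ->
     [/\ path (arc D) x (L x), uniq (x :: L x) & last x (L x) \in T]) /\
  (forall x y z, x \in X -> y \in X -> z \in x :: L x -> z \in y :: L y ->
     x = y).

Lemma linked_sub D T X Y : X `<=` Y -> linked D T Y -> linked D T X.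
Proof.
move=> /fsubsetP XY [L [LP Ldis]]; exists L; split=> [x /XY /LP //|].
by move=> x y z /XY xY /XY yY; apply: Ldis.
Qed.

Lemma path_vertices D x p :
  x \in vertices D -> path (arc D) x p -> {subset x :: p <= vertices D}.
Proof.
elim: p x => [|y p IHp] x xV /=.
  by move=> _ z; rewrite inE => /eqP->.
case/andP=> /arc_vertices[_ yV] /(IHp _ yV) sub z.
by rewrite inE => /predU1P[->|/sub].
Qed.

(** One path of the routing is chosen for each [x] in [X]; paths chosen for different [x] have
    different first vertices, hence are disjoint. *)
Lemma routing_linked D T X : X `<=` vertices D ->
  (exists R, is_routing D X T R) <-> linked D T X.
Proof.
move=> /fsubsetP XV; split=> [[R [Rpath Rstart Rend Rdis]]|[L [LP Ldis]]].
  have /choice[L LP] x : exists q, x \in X -> x :: q \in R.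
    have [/Rstart[p pR [q eqp]]|_] := boolP (x \in X); last by exists [::].
    by exists q; rewrite -eqp.
  exists L; split=> [x /LP xR | x y z xX yX zx zy].
    have [_ _ uniqL pathL] := Rpath _ xR; split=> //.
    have [t tT [q eqL]] := Rend _ xR.
    by have := congr1 (last x) eqL; rewrite last_rcons /= => ->.
  apply/eqP/negPn/negP => /eqP xy.
  by apply: (Rdis _ _ (LP x xX) (LP y yX) _ z) => [[]|].
exists [fset x :: L x | x in X]; split.
- move=> _ /imfsetP[x /= xX ->]; have [pathL uniqL _] := LP x xX.
  by split=> //; apply: path_vertices => //; apply: XV.
- move=> x xX; exists (x :: L x); last by exists (L x).
  by apply/imfsetP; exists x.
- move=> _ /imfsetP[x /= xX ->]; have [_ _ lastT] := LP x xX.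
  by exists (last x (L x)) => //; exists (belast x (L x)); rewrite lastI.
- move=> _ _ /imfsetP[x /= xX ->] /imfsetP[y /= yX ->] neq z [zx zy].
  by apply: neq; rewrite (Ldis x y z).
Qed.

(* The iterates of h starting in X are the paths of a linking; h fixes the
   vertices off the paths. *)
Definition matched D T X : Prop := exists h : K -> K,
  [/\ {in vertices D `\` T &, injective h},
      {in vertices D `\` T, forall v, h v \in vertices D `\` X}
    & {in vertices D `\` T, forall v, h v = v \/ arc D v (h v)}].

(** [h] moves a vertex of a path to its successor. A value in [X] would be the first vertex of the
    path it lies on, but a successor never has position 0. *)
Lemma linked_matched D T X : X `<=` vertices D ->
  linked D T X -> matched D T X.
Proof.
move=> /fsubsetP XV [L [LP Ldis]].
pose on v (x : X) := v \in val x :: L (val x).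
(* The default [v] never matters: a vertex of a path that lies outside [T] is not the last one. *)
pose succ v x := nth v (x :: L x) (index v (x :: L x)).+1.
pose h v := if [pick x | on v x] is Some x then succ v (val x) else v.
have hP v : v \notin T ->
    (exists x, [/\ x \in X, v \in x :: L x,
       (index v (x :: L x)).+1 < size (x :: L x) & h v = succ v x])
    \/ (forall x, x \in X -> v \notin x :: L x) /\ h v = v.
  move=> vNT; rewrite /h; case: pickP => [[x xX] onx | offx]; last first.
    right; split=> // x xX; apply/negP => vx.
    by have := offx [` xX]; rewrite /on /= vx.
  left; exists x; split=> //; rewrite /on /= in onx.
  have [_ uniqL lastT] := LP x xX.
  rewrite ltn_neqAle index_mem onx andbT.
  apply: contraNneq vNT => eqs; suff -> : v = last x (L x) by [].
  rewrite -(nth_index v onx) (last_nth v) /=; congr nth.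
  by have := eqs => /= -[].
have succ_on v x : (index v (x :: L x)).+1 < size (x :: L x) ->
    succ v x \in x :: L x by exact: mem_nth.
(* This confines [v] and [w] with [h v = h w] to one path, where injectivity becomes a comparison of
   positions. *)
have hon v x : v \notin T -> x \in X -> h v \in x :: L x -> v \in x :: L x.
  move=> /hP[[y [yX vy lty ->]] xX sx | [_ ->] //].
  by rewrite (Ldis x y (succ v y)) //; apply: succ_on.
exists h; split.
- move=> v w; rewrite !inE => /andP[vNT _] /andP[wNT _] eqh.
  have [[x [xX vx ltx eqv]]|[offv eqv]] := hP v vNT.
    have hvx : h v \in x :: L x by rewrite eqv succ_on.
    have wx : w \in x :: L x by apply: hon => //; rewrite -eqh.
    have [[y [yX wy lty eqw]]|[offw _]] := hP w wNT; last first.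
      by have := offw x xX; rewrite wx.
    have exy : x = y by apply: (Ldis x y w).
    subst y; have [_ uniqL _] := LP x xX.
    move: eqh; rewrite eqv eqw /succ (set_nth_default w) // => /eqP.
    rewrite nth_uniq // eqSS => /eqP eqi.
    by rewrite -(nth_index w vx) eqi nth_index.
  have [[y [yX wy lty eqw]]|[_ eqw]] := hP w wNT; last by rewrite -eqv eqh.
  have : v \in y :: L y by rewrite -eqv eqh eqw succ_on.
  by rewrite (negPf (offv y yX)).
- move=> v; rewrite !inE => /andP[vNT vV].
  have [[x [xX vx ltx eqv]]|[offv ->]] := hP v vNT; last first.
    by rewrite vV andbT; apply/negP => /offv; rewrite mem_head.
  have [pathL uniqL _] := LP x xX; rewrite eqv; apply/andP; split.
    apply/negP => sX; have exs : x = succ v x.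
      by apply: (Ldis x _ (succ v x)); rewrite ?mem_head ?succ_on.
    have /eqP : nth v (x :: L x) 0 =
        nth v (x :: L x) (index v (x :: L x)).+1 := exs.
    by rewrite nth_uniq.
  by apply: (path_vertices (XV x xX) pathL); apply: succ_on.
- move=> v; rewrite inE => /andP[vNT _].
  have [[x [xX vx ltx ->]]|[_ ->]] := hP v vNT; last by left.
  right; have [pathL _ _] := LP x xX.
  have := pathP v pathL (index v (x :: L x)) ltx.
  by rewrite (nth_index v vx).
Qed.

(** From each [x] the map [h] is followed up to the first vertex in [T]. Its injectivity, and the
    fact that its values avoid [X], make these trajectories repetition-free and disjoint. *)
Lemma matched_linked D T X : X `<=` vertices D ->
  matched D T X -> linked D T X.
Proof.
move=> /fsubsetP XV [h [hinj hV harc]].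
(* The bound is strict: the [i]-th iterate itself may lie in [T], where [h] is no longer
   controlled. *)
pose before x i := forall k, k < i -> iter k h x \notin T.
have iterV x i : x \in X -> before x i -> iter i h x \in vertices D.
  move=> xX; elim: i => [|i IHi] bef; first exact: XV.
  have /hV : iter i h x \in vertices D `\` T.
    by rewrite inE bef // IHi // => k ki; apply: bef; apply: ltnW.
  by rewrite inE => /andP[].
(* Applications of [h] are peeled off both sides; if one side runs out first, an element of [X]
   would be a value of [h]. *)
have cancel x y i j : x \in X -> y \in X -> before x i -> before y j ->
    iter i h x = iter j h y -> i = j /\ x = y.
  move=> xX yX; have beforeW z n : before z n.+1 -> before z n.
    by move=> bef k kn; apply: bef; apply: ltnW.
  have inVT z n : z \in X -> before z n.+1 -> iter n h z \in vertices D `\` T.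
    by move=> zX bef; rewrite inE bef //= iterV //; apply: beforeW.
  elim: i j => [|i IHi] [|j] //= bi bj.
  - by move=> eqx; have := hV _ (inVT _ _ yX bj); rewrite -eqx inE xX.
  - by move=> eqy; have := hV _ (inVT _ _ xX bi); rewrite eqy inE yX.
  - move=> /(hinj _ _ (inVT _ _ xX bi) (inVT _ _ yX bj)) eqij.
    by have [-> ->] := IHi _ (beforeW _ _ bi) (beforeW _ _ bj) eqij.
have traj_uniq x n : x \in X -> before x n -> uniq (traject h x n.+1).
  move=> xX bef; apply/(uniqP x) => i j; rewrite !inE size_traject => li lj.
  rewrite !nth_traject // => /(cancel _ _ _ _ xX xX)[] //.
  - by move=> k ki; apply: bef; apply: leq_trans ki _; rewrite -ltnS.
  - by move=> k kj; apply: bef; apply: leq_trans kj _; rewrite -ltnS.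
have hits x : x \in X -> exists n, iter n h x \in T.
  move=> xX; apply: contrapT => never.
  have bef n : before x n.
    by move=> k _; apply/negP => kT; apply: never; exists k.
  (* A trajectory that never meets [T] would contain more distinct vertices than [D] has. *)
  have : size (traject h x #|` vertices D|.+1) <= size (enum_fset (vertices D)).
    apply: uniq_leq_size (traj_uniq _ _ xX (bef _)) _ => _ /trajectP[i _ ->].
    exact: iterV.
  by rewrite size_traject ltnn.
have /choice[n nP] x : exists n, x \in X -> iter n h x \in T /\ before x n.
  have [/hits ex|_] := boolP (x \in X); last by exists 0.
  case: (ex_minnP ex) => m mT minm; exists m => _; split=> // k km.
  by apply/negP => /minm; rewrite leqNgt km.
exists (fun x => traject h (h x) (n x)); split=> [x xX|x y z xX yX].
  have [nT bef] := nP x xX; have uq := traj_uniq _ _ xX bef.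
  split=> //; last by rewrite last_traject.
  apply/(pathP x) => i; rewrite size_traject => lti.
  have -> : x :: traject h (h x) (n x) = traject h x (n x).+1 by [].
  rewrite (nth_traject _ (leqW lti)).
  rewrite (set_nth_default (h x)) ?size_traject // nth_traject // -iterSr iterS.
  case: (harc (iter i h x)) => //.
    by rewrite inE bef //= iterV // => k ki; apply/bef/(ltn_trans ki).
  (* A fixed iterate would coincide with the next one and force [i = i.+1], so every step follows an
     arc. *)
  move=> fixi; have [|||eqi _] := cancel x x i i.+1 xX xX.
  - by move=> k ki; apply/bef/(ltn_trans ki).
  - by move=> k ki; apply: bef; apply: leq_trans ki _.
  - exact: esym.
  by have /n_Sn := eqi.
have [_ befx] := nP x xX; have [_ befy] := nP y yX.
move=> /(@trajectP _ h x (n x).+1)[i li ->] /(@trajectP _ h y (n y).+1)[j lj].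
move=> /(cancel _ _ _ _ xX yX)[] //.
- by move=> k ki; apply: befx; apply: leq_trans ki _; rewrite -ltnS.
- by move=> k kj; apply: befy; apply: leq_trans kj _; rewrite -ltnS.
Qed.

Lemma routing_matched D T X : X `<=` vertices D ->
  (exists R, is_routing D X T R) <-> matched D T X.
Proof.
move=> XV; apply: iff_trans (routing_linked T XV) _.
by split; [exact: linked_matched | exact: matched_linked].
Qed.

Lemma represents_matched D T M :
  represents D T M <->
  [/\ ground M `<=` vertices D, T `<=` vertices D
    & forall X, X \in indep M <-> X `<=` ground M /\ matched D T X].
Proof.
by split=> -[EV TV MP]; split=> // X; apply: iff_trans (MP X) _; split=> -[XE];
  move/(routing_matched T (fsubset_trans XE EV)).
Qed.

Lemma represents_linked D T M :
  represents D T M <->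
  [/\ ground M `<=` vertices D, T `<=` vertices D
    & forall X, X \in indep M <-> X `<=` ground M /\ linked D T X].
Proof.
by split=> -[EV TV MP]; split=> // X; apply: iff_trans (MP X) _; split=> -[XE];
  move/(routing_linked T (fsubset_trans XE EV)).
Qed.

(** * Digraphs given by a relation, left inverses and fresh vertices *)

Section DigraphOf.
Variables (V : {fset K}) (e : rel K).

Definition arcs_of : {fset K * K} := [fset p in V `*` V | e p.1 p.2].

Fact arcs_of_vertices : arcs_of `<=` V `*` V.
Proof. by apply/fsubsetP => p; rewrite !inE => /andP[]. Qed.

Definition digraph_of : digraph K := Digraph arcs_of_vertices.

Lemma arc_digraph_of u v : arc digraph_of u v = [&& u \in V, v \in V & e u v].
Proof. by rewrite /arc !inE /= andbA. Qed.

End DigraphOf.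

Lemma inj_cancel_fset V (f : K -> K) : {in V &, injective f} ->
  exists g, {in V, cancel f g}.
Proof.
move=> finj.
have /choice[g gP] y : exists x, y \in f @` V -> x \in V /\ f x = y.
  have [/imfsetP[x /= xV ->]|_] := boolP (y \in f @` V); last by exists y.
  by exists x.
exists g => x xV; have fxV : f x \in f @` V by by apply: in_imfset.
have [gV eqf] := gP _ fxV.
exact: finj.
Qed.

(** A finite set [C] with at least as many elements as [V] and [W] together keeps enough of them
    outside [W]; each [v] goes to the element with the same position there. *)
Lemma fresh_injection V W : infinite_set [set: K]%classic ->
  exists g : K -> K, {in V &, injective g} /\ {in V, forall v, g v \notin W}.
Proof.
move=> K_infinite.
have [C _ leC] := infinite_set_fset (#|` V| + #|` W|) K_infinite.
have leV : #|` V| <= #|` C `\` W|.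
  rewrite -(leq_add2r #|` W|) (leq_trans leC) // -(cardfsID W C) addnC leq_add2l.
  exact/fsubset_leq_card/fsubsetIr.
have lt_index v : v \in V -> index v V < size (C `\` W).
  by move=> vV; apply: leq_trans leV; rewrite index_mem.
exists (fun v => nth v (C `\` W) (index v V)); split=> [u v uV vV|v vV].
  rewrite (set_nth_default v) ?lt_index // => /eqP.
  rewrite nth_uniq ?lt_index // => /eqP eqi.
  by rewrite -(nth_index v uV) eqi nth_index.
by have := mem_nth v (lt_index v vV); rewrite inE => /andP[].
Qed.

(** * Normalising a representation: sources, base exchange, a base as target set *)

Definition sources D X := forall u v, v \in X -> ~~ arc D u v.
Definition sinks D X := forall u v, u \in X -> ~~ arc D u v.

(* The new digraph consists of a copy g @` vertices D of D, where g avoids the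
   ground set of N, and of an arc from f x to g x for each x in the ground set
   of M. *)
Lemma sources_representation M N :
  infinite_set [set: K]%classic -> gammoid M -> isomorphic M N ->
  exists D T, [/\ represents D T N, sources D (ground N)
                & [disjoint T & ground N]].
Proof.
move=> K_infinite [D [T /represents_matched[]]].
set V := vertices D; set E := ground M => EV TV MP [f [finj fE fI]].
have [g [ginj gF]] := fresh_injection V (f @` E) K_infinite.
have [f' fK] := inj_cancel_fset finj; have [g' gK] := inj_cancel_fset ginj.
pose V1 := f @` E `|` g @` V; pose T1 := g @` T.
(* Every arc ends in the copy, which makes all the vertices [f x] sources. *)
pose e1 u v := (v \in g @` V) &&
  (if u \in g @` V then arc D (g' u) (g' v) else v == g (f' u)).
pose D1 := digraph_of V1 e1.
have memE x : x \in E -> x \in V by apply/fsubsetP.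
have memT x : x \in T -> x \in V by apply/fsubsetP.
have gV v : v \in V -> g v \in g @` V by exact: in_imfset.
have fEP x : x \in E -> f x \in f @` E by exact: in_imfset.
have fNg x : x \in E -> (f x \in g @` V) = false.
  move=> xE; apply/negP => /imfsetP[v /= vV eqf].
  by have := gF v vV; rewrite -eqf fEP.
have arcgg u v : u \in V -> v \in V -> arc D1 (g u) (g v) = arc D u v.
  by move=> uV vV; rewrite arc_digraph_of /e1 !inE !gV // !gK // !orbT.
have arcfg x v : x \in E -> v \in V -> arc D1 (f x) (g v) = (v == x).
  move=> xE vV; rewrite arc_digraph_of /e1 !inE fNg // !gV // fEP // orbT /= fK //.
  by apply/eqP/eqP => [/ginj->|->] //; exact: memE.
have arcf u x : x \in E -> arc D1 u (f x) = false.
  by move=> xE; rewrite arc_digraph_of /e1 fNg // !andbF.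
have V1T1 w : w \in V1 `\` T1 <-> (exists2 v, v \in V `\` T & w = g v)
    \/ (exists2 x, x \in E & w = f x).
  split.
    rewrite !inE => /andP[wT1 /orP[]] /imfsetP[x /= xP eqw]; [right|left].
      by exists x.
    exists x => //; rewrite inE xP andbT; apply: contra wT1 => xT.
    by rewrite eqw; apply: in_imfset.
  case=> -[x xP ->]; rewrite !inE.
    move: xP; rewrite inE => /andP[xT xV]; rewrite gV // orbT andbT.
    by apply/negP => /imfsetP[y /= yT /ginj eqxy]; rewrite eqxy ?yT // ?memT in xT.
  rewrite fEP // andbT; apply/negP => /imfsetP[y /= yT eqf].
  by have := fNg x xP; rewrite eqf gV // memT.
have main X : X `<=` E -> matched D T X <-> matched D1 T1 (f @` X).
  move=> /fsubsetP XE.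
  have fX x : x \in E -> (f x \in f @` X) = (x \in X).
    move=> xE; apply/idP/idP => [/imfsetP[y /= yX /finj->] //|].
      exact: XE.
    exact: in_imfset.
  have gNX v : v \in V -> (g v \in f @` X) = false.
    move=> vV; apply/negP => /imfsetP[x /= /XE xE eqg].
    by have := fNg x xE; rewrite -eqg gV.
  split=> -[h [hinj hV harc]].
    have hVP v : v \in V `\` T -> h v \in V /\ h v \notin X.
      by move=> /hV; rewrite inE => /andP[].
    (* For [x] in [X], the vertex [f x] moves to [g x], a place left free because [h] avoids [X]. *)
    pose h1 w := if w \in g @` V then g (h (g' w)) else
                 if f' w \in X then g (f' w) else w.
    have h1g v : v \in V `\` T -> h1 (g v) = g (h v).
      by rewrite inE => /andP[_ vV]; rewrite /h1 gV // gK.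
    have h1f x : x \in E -> h1 (f x) = if x \in X then g x else f x.
      by move=> xE; rewrite /h1 fNg // fK.
    have mixed v x : v \in V `\` T -> x \in E -> h1 (g v) <> h1 (f x).
      move=> vVT xE; rewrite h1g // h1f //; have [hvV hvX] := hVP v vVT.
      case: ifP => [xX /ginj eqh|_ eqh].
        by move: hvX; rewrite eqh ?xX // memE.
      by have := fNg x xE; rewrite -eqh gV.
    exists h1; split.
    - move=> w1 w2 /V1T1[[v1 v1P ->]|[x1 x1P ->]] /V1T1[[v2 v2P ->]|[x2 x2P ->]].
      + have [? _] := hVP _ v1P; have [? _] := hVP _ v2P.
        by rewrite !h1g // => /ginj eqh; rewrite (hinj v1 v2) // eqh.
      + by move/mixed; case.
      + by move/esym/mixed; case.
      + rewrite !h1f //; case: ifP => x1X; case: ifP => x2X //.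
        * by move/ginj => -> //; exact: memE.
        * by move=> eqg; have := fNg x2 x2P; rewrite -eqg gV // memE.
        * by move=> eqg; have := fNg x1 x1P; rewrite eqg gV // memE.
    - move=> w /V1T1[[v vP ->]|[x xE ->]].
        have [hvV _] := hVP v vP.
        by rewrite h1g // !inE gNX // gV // orbT.
      rewrite h1f // !inE; case: ifP => xX; last by rewrite fX // xX fEP.
      by rewrite gNX ?gV ?memE // orbT.
    - move=> w /V1T1[[v vP ->]|[x xE ->]].
        have [hvV _] := hVP v vP; rewrite h1g //.
        have vV : v \in V by move: vP; rewrite inE => /andP[].
        by case: (harc v vP) => [->|arcv]; [left | right; rewrite arcgg].
      rewrite h1f //; case: ifP => xX; last by left.
      by right; rewrite arcfg ?memE.
  (* No arc enters a vertex [f x], so [h] maps copies to copies and can be pulled back along [g]. *)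
  have hg v : v \in V `\` T ->
      exists2 u, u \in V & h (g v) = g u /\ (u = v \/ arc D v u).
    move=> vP; have vV : v \in V by move: vP; rewrite inE => /andP[].
    have gvP : g v \in V1 `\` T1 by apply/V1T1; left; exists v.
    case: (harc _ gvP) => [->|arcv]; first by exists v => //; split; [|left].
    have: h (g v) \in g @` V by move: arcv; rewrite arc_digraph_of => /and4P[].
    case/imfsetP=> u /= uV eqh; exists u => //; split=> //; right.
    by rewrite -arcgg // -eqh.
  have hgV v : v \in V `\` T -> h (g v) = g (g' (h (g v))).
    by move=> /hg[u uV [-> _]]; rewrite gK.
  have gVT v : v \in V `\` T -> g v \in V1 `\` T1.
    by move=> vP; apply/V1T1; left; exists v.
  exists (fun v => g' (h (g v))); split.
  - move=> u v uP vP eqh; apply: ginj.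
    + by move: uP; rewrite inE => /andP[].
    + by move: vP; rewrite inE => /andP[].
    by apply: hinj; rewrite ?gVT // hgV // eqh -hgV.
  - move=> v vP; have [u uV [eqh _]] := hg v vP.
    rewrite eqh gK // inE uV andbT; apply/negP => uX; have uE := XE u uX.
    have fuP : f u \in V1 `\` T1 by apply/V1T1; right; exists u.
    (* With [u] in [X], the vertex [f u] cannot be fixed and its only arc leads to [g u]; by
       injectivity [g v] cannot go there too. *)
    have eqfu : h (f u) = g u.
      case: (harc _ fuP) => [fix_u|].
        by have := hV _ fuP; rewrite fix_u inE fX // uX.
      rewrite arc_digraph_of /e1 fNg // fK // => /and4P[_ _ _] /eqP.
      by [].
    have := fNg u uE; rewrite (hinj (f u) (g v)) ?gVT ?gV //.
      by move: vP; rewrite inE => /andP[].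
    by rewrite eqfu eqh.
  - by move=> v vP; have [u uV [-> ]] := hg v vP; rewrite gK.
have preim X1 : X1 `<=` ground N -> exists2 X, X `<=` E & X1 = f @` X.
  rewrite -fE => /fsubsetP X1E; exists (f' @` X1).
    apply/fsubsetP => _ /imfsetP[z /= /X1E/imfsetP[x /= xE ->] ->].
    by rewrite fK.
  apply/fsetP => y; apply/idP/imfsetP => /= [yX1|[_ /imfsetP[z /= zX1 ->] ->]].
    have /imfsetP[x /= xE eqy] := X1E y yX1.
    by exists x => //; apply/imfsetP; exists y; rewrite // eqy fK.
  by have /imfsetP[x /= xE eqz] := X1E z zX1; move: zX1; rewrite eqz fK.
exists D1, T1; split.
- apply/represents_matched; split.
  + by rewrite -fE; exact: fsubsetUl.
  + apply/fsubsetP => _ /imfsetP[v /= vT ->]; rewrite !inE.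
    by rewrite gV ?orbT // memT.
  + move=> X1; split=> [X1I|[/preim[X XE ->]]].
      have [X XE eqX1] := preim X1 (indep_ground X1I); subst X1.
      split; first exact: indep_ground X1I.
      by apply/main => //; move: X1I; rewrite -fI // => /MP[].
    by move/main => Xm; rewrite -fI //; apply/MP; split; last exact: Xm.
- by move=> u v; rewrite -fE => /imfsetP[x /= xE ->]; rewrite arcf.
- apply/fdisjointP => _ /imfsetP[v /= vT ->]; rewrite -fE gF //.
  exact: memT.
Qed.

(** Matchings for [D] and for [D'] turn into each other by composition with [g], the inverse of
    [h0], and with [h0], so the same sets are matched. *)
Lemma base_exchange D T M B :
  represents D T M -> sources D (ground M) -> [disjoint T & ground M] ->
  B \in bases M ->
  exists D' T', [/\ represents D' T' M, B `<=` T', sinks D' T'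
                  & sources D' (ground M `\` B)].
Proof.
case/represents_matched=> [EV TV MP] srcD disT /basesP[BI maxB].
have [BE [h0 [h0inj h0V h0arc]]] := (MP B).1 BI.
set V := vertices D in EV TV h0inj h0V h0arc; set E := ground M.
have [g hK] := inj_cancel_fset h0inj.
pose e' w u := [&& w \in h0 @` (V `\` T), u != w & (u == g w) || arc D (g w) u].
pose D' := digraph_of V e'; pose T' := V `\` h0 @` (V `\` T).
have hin v : v \in V `\` T -> h0 v \in h0 @` (V `\` T) by exact: in_imfset.
have VT'P w : w \in V `\` T' <-> exists2 v, v \in V `\` T & w = h0 v.
  rewrite !inE negb_and negbK; split=> [/andP[/orP[|/negPf->//]]|].
    by case/imfsetP=> v /= vP -> _; exists v.
  case=> v vP ->; rewrite hin //=.
  by have := h0V v vP; rewrite inE => /andP[].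
have main X : matched D T X <-> matched D' T' X.
  split=> -[h [hinj hV harc]].
    exists (fun w => h (g w)); split.
    - by move=> _ _ /VT'P[v vP ->] /VT'P[w wP ->]; rewrite !hK // => /hinj->.
    - by move=> _ /VT'P[v vP ->]; rewrite hK //; apply: hV.
    - move=> _ /VT'P[v vP ->]; rewrite hK //.
      have [->|neq] := eqVneq (h v) (h0 v); first by left.
      right; rewrite arc_digraph_of /e' hin // neq hK //.
      have := h0V v vP; have := hV v vP; rewrite !inE.
      move=> /andP[_ ->] /andP[_ ->] /=.
      by case: (harc v vP) => [->|->]; rewrite ?eqxx ?orbT.
  have h0T' v : v \in V `\` T -> h0 v \in V `\` T' by move=> vP; apply/VT'P; exists v.
  exists (fun v => h (h0 v)); split.
  - by move=> v w vP wP /hinj eqh; apply: h0inj => //; apply: eqh; apply: h0T'.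
  - by move=> v vP; apply/hV/h0T'.
  - move=> v vP; case: (harc _ (h0T' v vP)) => [->|]; first exact: h0arc.
    rewrite arc_digraph_of /e' hK // => /and5P[_ _ _ _ /orP[/eqP|]]; first by left.
    by right.
have T'V : T' `<=` V by exact: fsubsetDl.
have repr : represents D' T' M.
  apply/represents_matched; split=> // X.
  by apply: iff_trans (MP X) _; split=> -[XE /main].
have BT' : B `<=` T'.
  apply/fsubsetP => b bB; rewrite inE (fsubsetP EV) ?(fsubsetP BE) // andbT.
  by apply/negP => /imfsetP[v /= /h0V hv eqb]; move: hv; rewrite -eqb inE bB.
(* [h0] takes no value in [T'], so it also matches this intersection, which is therefore independent
   and cannot exceed the base [B]. *)
have T'E : T' `&` E = B.
  apply: maxB; last by rewrite fsubsetI BT'.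
  apply/MP; split; first exact: fsubsetIr.
  exists h0; split=> // v vP; have := h0V v vP; rewrite !inE hin //=.
  by case/andP.
exists D', T'; split=> //.
- move=> u v; rewrite !inE => /andP[uN _]; rewrite arc_digraph_of /e'.
  by rewrite (negPf uN) !andbF.
- move=> u v; rewrite inE => /andP[vNB vE]; rewrite arc_digraph_of /e'.
  apply/negP => /and5P[_ vV /imfsetP[w /= wP ->]]; rewrite hK // => neq.
  have NarcE x : arc D x v = false by apply: negbTE; exact: srcD.
  rewrite NarcE orbF => /eqP eqv; subst w.
  case: (h0arc v wP) => [eqh|arch]; first by rewrite eqh eqxx in neq.
  (* What remains is an arc from [h0 v] to [v] with [h0 v] distinct from [v]. Outside [T'], however,
     [v] is a value of [h0], and a source of [D] can only be the value at itself. *)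
  have : v \notin T'.
    by apply: contra vNB => vT'; rewrite -T'E inE vT' vE.
  rewrite inE vV andbT negbK => /imfsetP[w /= wP' eqv].
  case: (h0arc w wP') => [eqw|]; last by rewrite -eqv NarcE.
  by move: neq; rewrite eqv eqw -{1}eqw -eqv eqxx.
Qed.

Lemma path_sink D x p b : path (arc D) x p -> b \in x :: p ->
  (forall v, ~~ arc D b v) -> b = last x p.
Proof.
move=> + + sink; elim: p x => [|y p IHp] x /=; first by rewrite inE => _ /eqP.
case/andP=> arcxy pathp; rewrite inE => /predU1P[eqb|]; last exact: IHp.
by have := sink y; rewrite eqb arcxy.
Qed.

Lemma path_source D x p b : path (arc D) x p -> b \in x :: p ->
  (forall v, ~~ arc D v b) -> b = x.
Proof.
move=> + + source; elim: p x => [|y p IHp] x /=; first by rewrite inE => _ /eqP.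
case/andP=> arcxy pathp; rewrite inE => /predU1P[//|bp].
by have := source x; rewrite (IHp y pathp bp) arcxy.
Qed.

(* A path from x ending in T outside B would, together with the trivial paths
   on the sinks B, link B + x to T. *)
Lemma represents_base D T M B : represents D T M -> B \in bases M ->
  B `<=` T -> sinks D T -> represents D B M.
Proof.
case/represents_linked=> [EV TV MP] /basesP[BI maxB] BT sinkT.
apply/represents_linked; split=> //; first exact: fsubset_trans TV.
move=> X; apply: iff_trans (MP X) _; split=> -[XE [L [LP Ldis]]]; split=> //;
  exists L; split=> // x xX; have [pathL uniqL lastT] := LP x xX; split=> //;
  last exact: (fsubsetP BT).
have sinkB b : b \in B -> forall v, ~~ arc D b v.
  by move=> bB v; apply/sinkT/(fsubsetP BT).
apply/negPn/negP => lastNB.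
have offB b : b \in B -> b \notin x :: L x.
  move=> bB; apply: contra lastNB => bx.
  by rewrite -(path_sink pathL bx (sinkB b bB)).
have xNB : x \notin B by apply/negP => /offB; rewrite mem_head.
have xB : x |` B = B.
  apply: maxB; last exact: fsubsetU1.
  apply/MP; split.
    by rewrite fsubUset fsub1set (fsubsetP XE) //= (indep_ground BI).
  exists (fun y => if y == x then L x else [::]); split=> [y|y z t].
    rewrite in_fset1U; have [-> //|_ /= yB] := eqVneq y x.
    by split=> //; exact: (fsubsetP BT).
  rewrite !in_fset1U; have [->|_] := eqVneq y x; have [->|_] := eqVneq z x => //=.
  - by move=> _ zB tx; rewrite inE => /eqP eqt; have := offB z zB; rewrite -eqt tx.
  - by move=> yB _; rewrite inE => /eqP-> /(negP (offB y yB)).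
  - by move=> _ _; rewrite !inE => /eqP-> /eqP.
by have := fset1U1 x B; rewrite xB (negPf xNB).
Qed.

(** * Path reversal, and duals of gammoids *)

Definition reverse D := digraph_of (vertices D) (fun u v => arc D v u).

Lemma arc_reverse D u v : arc (reverse D) u v = arc D v u.
Proof.
rewrite arc_digraph_of; apply/and3P/idP => [[]//|arcvu].
by have [? ?] := arc_vertices arcvu.
Qed.

(* Y consists of U minus X and the ends of the paths that start in X and U. *)
Lemma linked_reverse D U W X :
  sources D U -> sinks D W -> [disjoint U & W] -> X `<=` U `|` W ->
  linked D W X ->
  exists Y, [/\ Y `<=` U `|` W, [disjoint X & Y], #|` Y| = #|` U|
              & linked (reverse D) U Y].
Proof.
move=> srcU sinkW UW /fsubsetP XUW [L [LP Ldis]].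
(* Paths that start in [W] are trivial, its vertices being sinks; only those that start in [U] are
   reversed. *)
pose ends := [fset last x (L x) | x in X `&` U].
have inXU x : x \in X `&` U -> x \in X /\ x \in U.
  by rewrite inE => /andP.
have endsW y : y \in ends -> y \in W.
  by case/imfsetP=> x /= /inXU[xX _] ->; have [] := LP x xX.
have WNU y : y \in W -> y \notin U.
  by move=> yW; apply/negP => yU; have /fdisjointP/(_ y yU) := UW; rewrite yW.
have last_inj : {in X `&` U &, injective (fun x => last x (L x))}.
  move=> x y /inXU[xX _] /inXU[yX _] /= eqxy.
  apply: (Ldis x y (last x (L x))) => //; first exact: mem_last.
  by rewrite eqxy; exact: mem_last.
have [start startK] := inj_cancel_fset last_inj.
have offX u : u \in U `\` X -> forall x, x \in X -> u \notin x :: L x.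
  rewrite inE => /andP[uNX uU] x xX; apply/negP => ux.
  have [pathL _ _] := LP x xX.
  by move: uNX; rewrite (path_source pathL ux) ?xX // => v; apply: srcU.
exists (U `\` X `|` ends); split.
- rewrite fsubUset; apply/andP; split.
    by apply: fsubset_trans (fsubsetDl _ _) (fsubsetUl _ _).
  by apply/fsubsetP => y /endsW; rewrite inE orbC => ->.
(* By disjointness of the paths, an end in [X] would be the start of its own path, hence in both [U]
   and [W]. *)
- apply/fdisjointP => x xX; rewrite !inE xX /=.
  apply/negP => /imfsetP[y /= /inXU[yX yU] eqx].
  have xy : x \in y :: L y by rewrite eqx; exact: (mem_last y (L y)).
  have exy := Ldis x y x xX yX (mem_head _ _) xy.
  have [_ _] := LP y yX; rewrite -eqx => /WNU.
  by rewrite exy yU.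
- have -> : #|` U `\` X `|` ends| = (#|` U `\` X| + #|` ends|)%N.
    rewrite -cardfsUI; suff -> : (U `\` X) `&` ends = fset0.
      by rewrite cardfs0 addn0.
    apply/fsetP => y; rewrite in_fsetI in_fset0; apply/negP => /andP[].
    by rewrite inE => /andP[_ yU] /endsW/WNU; rewrite yU.
  by have /card_in_imfsetP/eqP-> := last_inj; rewrite fsetIC addnC cardfsID.
(* Vertices of [U] get trivial paths; from an end [y] the path runs backwards, and [belast] drops
   [y] itself, which is now the first vertex. *)
pose rL y := if y \in U then [::] else rev (belast (start y) (L (start y))).
have rLU u : u \in U -> rL u = [::] by rewrite /rL => ->.
have rLE x : x \in X `&` U -> rL (last x (L x)) = rev (belast x (L x)).
  move=> xXU; have [xX _] := inXU x xXU; have [_ _ lastW] := LP x xX.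
  by rewrite /rL (negPf (WNU _ lastW)) startK.
have rev_path_cons x : last x (L x) :: rev (belast x (L x)) = rev (x :: L x).
  by rewrite [x :: _]lastI rev_rcons.
have memY y : y \in U `\` X `|` ends ->
    (y \in U `\` X) \/ (exists2 x, x \in X `&` U & y = last x (L x)).
  by rewrite in_fsetU => /orP[|/imfsetP[x /= ? ->]]; [left | right; exists x].
have UXU u : u \in U `\` X -> u \in U by rewrite inE => /andP[].
exists rL; split=> [y /memY[yUX|[x xXU ->]] | y z t].
- by have yU := UXU y yUX; rewrite rLU.
- have [xX xU] := inXU x xXU; have [pathL uniqL _] := LP x xX.
  rewrite rLE // rev_path_cons rev_uniq; split=> //.
    rewrite rev_path; apply: sub_path pathL => u v.
    by rewrite arc_reverse.
  by case: (L x) => [|v p] //=; rewrite rev_cons last_rcons.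
move=> /memY[yUX|[x xXU ->]] /memY[zUX|[x' xXU' ->]].
- by rewrite !rLU ?UXU // !inE => /eqP-> /eqP.
- have [x'X _] := inXU x' xXU'; rewrite rLU ?UXU // rLE // rev_path_cons mem_rev.
  by rewrite inE => /eqP-> /(negP (offX _ yUX _ x'X)).
- have [xX _] := inXU x xXU; rewrite (rLU z) ?UXU // rLE // rev_path_cons mem_rev.
  by move=> + /predU1P[eqt|//]; rewrite eqt => /(negP (offX _ zUX _ xX)).
- have [xX _] := inXU x xXU; have [x'X _] := inXU x' xXU'.
  by rewrite !rLE // !rev_path_cons !mem_rev => tx tx'; rewrite (Ldis x x' t).
Qed.

(** Serves to identify the double reversal of [D] with [D] as far as linkings are concerned. *)
Lemma linked_eq_arc D D' T X : arc D =2 arc D' ->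
  linked D T X -> linked D' T X.
Proof.
move=> eqD [L [LP Ldis]]; exists L; split=> // x /LP[pathL ? ?]; split=> //.
by rewrite -(eq_path eqD).
Qed.

Lemma base_card M B C : B \in bases M -> C \in bases M -> #|` B| = #|` C|.
Proof.
move=> BB CB; have [BI _] := basesP _ _ BB; have [CI _] := basesP _ _ CB.
by apply/eqP; rewrite eqn_leq (indep_card_base BI CB) (indep_card_base CI BB).
Qed.

(** Reversal of a linking of a base [C] gives a linked set disjoint from [C] and as large as its
    complement in [E], hence equal to it. Conversely, reversal of a linking of [Y] gives an
    independent set of the size of a base that avoids [Y]. *)
Lemma gammoid_dual M : infinite_set [set: K]%classic ->
  gammoid M -> gammoid (dual M).
Proof.
move=> K_infinite gM.
have isoM : isomorphic M M.
  exists id; split=> //; first by rewrite imfset_id.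
  by move=> X _; rewrite imfset_id.
have [D0 [T0 [repr0 src0 dis0]]] := sources_representation K_infinite gM isoM.
have [B BB] := base_exists M.
have [D [T [reprT BT sinkT src]]] := base_exchange repr0 src0 dis0 BB.
have /represents_linked[EV BV MP] := represents_base reprT BB BT sinkT.
have [BI _] := basesP _ _ BB; have BE := indep_ground BI.
have sinkB : sinks D B by move=> u v uB; apply/sinkT/(fsubsetP BT).
set E := ground M in EV src BE; set U := E `\` B in src.
have UB : [disjoint U & B] by apply/fdisjointP => x; rewrite inE => /andP[].
have EUB : U `|` B = E by rewrite /U fsetUDr fsetDv fsetD0; apply/fsetUidPl.
have cardE : #|` E| = (#|` U| + #|` B|)%N.
  by rewrite addnC -(cardfsID B E); congr addn; rewrite fsetIC (fsetIidPl BE).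
exists (reverse D), U; apply/represents_linked; split.
- exact: EV.
- exact: fsubset_trans (fsubsetDl _ _) EV.
move=> Y; split=> [YI|[YE Ylinked]].
  split; first exact: (coindep_ground YI).
  have /coindepP[C CB YC] := YI; have [/MP[CE Clinked] _] := basesP _ _ CB.
  have [|Z [ZE CZ cardZ Zlinked]] := linked_reverse src sinkB UB _ Clinked.
    by rewrite EUB.
  rewrite EUB in ZE; apply: linked_sub Zlinked; apply: fsubset_trans YC _.
  suff -> : Z = E `\` C by [].
  apply/eqP; rewrite eqEfcard; apply/andP; split.
    apply/fsubsetP => z zZ; rewrite inE (fsubsetP ZE) // andbT.
    by apply/negP => zC; have /fdisjointP/(_ z zC) := CZ; rewrite zZ.
  rewrite cardZ -(leq_add2r #|` B|) -cardE -(cardfsID C E) addnC leq_add2r.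
  by rewrite (base_card BB CB) fsetIC (fsetIidPl CE).
(* In the reversed digraph [B] consists of sources and [U] of sinks, so the two sets exchange
   roles. *)
have [||||Z [ZE YZ cardZ Zlinked]] :=
    @linked_reverse (reverse D) B U Y _ _ _ _ Ylinked.
- by move=> u v vB; rewrite arc_reverse; apply: sinkB.
- by move=> u v uU; rewrite arc_reverse; apply: src.
- by rewrite fdisjoint_sym.
- by rewrite fsetUC EUB.
rewrite fsetUC EUB in ZE.
have ZI : Z \in indep M.
  apply/MP; split=> //; apply: linked_eq_arc Zlinked => u v.
  by rewrite !arc_reverse.
apply/coindepP; exists Z; first exact: base_of_card BB cardZ.
apply/fsubsetP => y yY; rewrite inE (fsubsetP YE) // andbT.
by have /fdisjointP := YZ; apply.
Qed.

(** * Duality as an involution, and invariance of gammoids under isomorphism *)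

Lemma bases_dual M B : B \in bases M -> ground M `\` B \in bases (dual M).
Proof.
move=> BB; have [BI maxB] := basesP _ _ BB; apply/basesP; split.
  by apply/coindepP; exists B.
move=> C /coindepP[B' BB' CB'] BC.
have [B'I _] := basesP _ _ BB'; have B'E := indep_ground B'I.
(* [C] contains the complement of [B] and lies in that of [B'], so [B'] is a subset of [B]; bases
   have equal size. *)
have eqB : B' = B.
  apply/eqP; rewrite eqEfcard (base_card BB BB') leqnn andbT.
  apply/fsubsetP => x xB'; apply/negPn/negP => xNB.
  have : x \in ground M `\` B by rewrite inE xNB (fsubsetP B'E).
  by move/(fsubsetP BC)/(fsubsetP CB'); rewrite inE xB'.
by apply/eqP; rewrite eqEfsubset BC andbT -{1}eqB.
Qed.

Lemma dual_indep M X : X \in indep M -> X \in indep (dual (dual M)).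
Proof.
move=> XI; have [B BB] := base_exists M; have [BI _] := basesP _ _ BB.
have [C [CI XC _ cardC]] := indep_extend XI BI (indep_card_base XI BB).
have CB : C \in bases M by exact: base_of_card BB cardC.
apply/coindepP; exists (ground M `\` C); first exact: bases_dual.
by rewrite fsetDK; last exact: (indep_ground CI).
Qed.

Lemma base_dual M B : B \in bases (dual M) -> ground M `\` B \in bases M.
Proof.
move=> /basesP[/coindepP[C CB BC] maxB].
have [CI _] := basesP _ _ CB.
have eqB : ground M `\` C = B by apply: maxB => //; apply/coindepP; exists C.
by rewrite -eqB fsetDK // indep_ground.
Qed.

Lemma dualK M : dual (dual M) = M.
Proof.
apply: matroid_eqP => //; apply/fsetP => X; apply/idP/idP; last exact: dual_indep.
case/coindepP=> B /base_dual BB XB; have [BI _] := basesP _ _ BB.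
exact: indep_sub BI.
Qed.

Lemma isomorphic_sym M N : isomorphic M N -> isomorphic N M.
Proof.
case=> f [finj fE fI]; have [g gK] := inj_cancel_fset finj.
have fK y : y \in ground N -> g y \in ground M /\ f (g y) = y.
  by rewrite -fE => /imfsetP[x /= xM ->]; rewrite gK.
exists g; split.
- move=> x y /fK[_ eqx] /fK[_ eqy] eqg.
  by rewrite -eqx -eqy eqg.
- apply/fsetP => x; apply/imfsetP/idP => /= [[y /fK[gyM _] ->] //|xM].
  by exists (f x); rewrite ?gK // -fE in_imfset.
- move=> X /fsubsetP XN; rewrite fI.
    suff {1}-> : X = f @` (g @` X) by [].
    apply/fsetP => y; apply/idP/imfsetP => /= [yX|].
      have [_ eqy] := fK _ (XN y yX).
      by exists (g y); rewrite ?eqy // in_imfset.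
    case=> _ /imfsetP[z /= zX ->] ->.
    by have [_ ->] := fK _ (XN z zX).
  apply/fsubsetP => _ /imfsetP[z /= zX ->].
  by have [] := fK _ (XN z zX).
Qed.

(** The passage to fresh vertices was carried out along an arbitrary isomorphism, so it transports
    representations as well. *)
Lemma gammoid_isomorphic M N : infinite_set [set: K]%classic ->
  isomorphic M N -> gammoid M <-> gammoid N.
Proof.
move=> K_infinite MN; split=> gM.
  by have [D [T [repr _ _]]] := sources_representation K_infinite gM MN; exists D, T.
have [D [T [repr _ _]]] :=
  sources_representation K_infinite gM (isomorphic_sym MN).
by exists D, T.
Qed.

Lemma gammoid_dualE M : infinite_set [set: K]%classic ->
  gammoid (dual M) <-> gammoid M.
Proof.
move=> K_infinite; split; last exact: gammoid_dual.
by move/(gammoid_dual K_infinite); rewrite dualK.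
Qed.

Lemma strict_gammoid_gammoid M : strict_gammoid M -> gammoid M.
Proof. by case=> D [T [_ repr]]; exists D, T. Qed.

End Linkings.

(** * Validity of the extended tableau *)

Local Open Scope classical_set_scope.

Theorem lemma3p8 (K : choiceType) (K_infinite : infinite_set [set: K]%classic)
  (T : tableau_data K) (T_tableau : is_tableau T) (T_valid : valid T) :
  is_tableau (extended T) /\ valid (extended T).
Proof.
case: T_tableau => teqS teq_refl _ _.
case: T_valid => gammoidsP nonstrictP nongammoidsP classP.
pose S := Defs.family (extended T).
have familyS : Defs.family T `<=` S.
  by move=> M [[[|]|]|] MT; [do 3 left|left; left; right; left
    |left; right; left|right; left].
pose Q := [set MN : matroid K * matroid K |
  [/\ S MN.1, S MN.2 & gammoid MN.1 <-> gammoid MN.2]].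
have equivQ : equivalence_on S Q.
  split=> [[M N] [] //|M SM|M N [? ? eqMN]|L M N [? ? eqLM] [? ? eqMN]].
  - by split.
  - by split=> //; apply: iff_sym.
  - by split=> //; apply: iff_trans eqLM eqMN.
have genQ : teq T `|` iso_or_dual S `<=` Q.
  move=> [M N] [MN|[/= SM SN isoNM]]; split=> //=.
  - by have [/familyS] := teqS _ MN.
  - by have [_ /familyS] := teqS _ MN.
  (* Reflexivity puts [M] into its own class, so the alternative that holds for this class settles
     [M] and [N] alike. *)
  - have [MT _] := teqS _ MN; have MM := teq_refl _ MT.
    by case: (classP M MT) => g; split=> gM;
      [exact: g|exact: g|case: (g M)|case: (g N)].
  - case: isoNM => /(gammoid_isomorphic K_infinite) NM; first exact: iff_sym.
    by apply: iff_trans (iff_sym (gammoid_dualE M K_infinite)) (iff_sym NM).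
have teqQ : teq (extended T) `<=` Q by apply: smallest_sub.
have nongammoidP M : nongammoids (extended T) M -> ~ gammoid M.
  case=> [/nongammoidsP //|[N /nongammoidsP NN <-]].
  by rewrite gammoid_dualE.
split.
  (* The smallest relation is an intersection: the closure properties are checked in each relation
     [R] intersected, while [Q] ensures that only members of [S] are related. *)
  split=> [[M N] /teqQ[] //|M SM|M N MN|L M N LM MN].
  - by move=> R [[_ reflR _ _] _]; apply: reflR.
  - by move=> R RP; have [[_ _ symR _] _] := RP; apply: symR; apply: MN RP.
  - move=> R RP; have [[_ _ _ transR] _] := RP.
    exact: transR (LM R RP) (MN R RP).
split=> //.
- by move=> M [/gammoidsP //|[N /gammoidsP gN <-]]; apply: gammoid_dual.
- move=> M [/nonstrictP //|/nongammoidP NM /strict_gammoid_gammoid].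
  by [].
move=> M SM; have [gM|NgM] := pselect (gammoid M).
  by left=> N /teqQ[_ _ /= [+ _]]; apply.
by right=> N /teqQ[_ _ /= [_ +]] gN => /(_ gN).
Qed.
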